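(* Suppose $\mathfrak{pse}\leq\aleph_2$. Let $X$ and $Y$ be compact Hausdorff pseudoradial spaces such that $X\times Y$ is weakly pseudoradial. Then $X\times Y$ is pseudoradial.
   Context: Convergence: for an infinite cardinal $\kappa$ (which may be taken regular), a sequence $\{x_\alpha:\alpha<\kappa\}$ of points of a space $X$ converges to $x\in X$ if for every neighborhood $U$ of $x$, $|\{\alpha<\kappa : x_\alpha\notin U\}|<\kappa$. A subset $A\subseteq X$ is radially closed if there is no sequence $\{x_\alpha:\alpha<\kappa\}\subseteq A$ (for any $\kappa$) that converges to a point of $X\setminus A$. The radial closure of $A$ is the smallest radially closed subset of $X$ containing $A$. A space is pseudoradial if the radial closure of every subset is closed. A space is weakly pseudoradial if the radial closure of every countable subset is closed. The pseudoradial number is $\mathfrak{pse}=\min\{\kappa : 2^\kappa \text{ is not pseudoradial}\}$, where $2^\kappa=\{0,1\}^\kappa$ carries the product topology (of discrete two-point spaces) and $\kappa$ ranges over cardinals. *)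

(* Defs.v *)
From mathcomp Require Import all_boot all_classical topology.

Set Implicit Arguments.
Unset Strict Implicit.
Unset Printing Implicit Defensive.

Local Open Scope classical_set_scope.
Local Open Scope card_scope.

(* Cardinals are represented by types: [K : Type] stands for the cardinal |K|.
   All the notions below depend on [K] only up to equipotence.               *)

Definition card_lt (S T : Type) (A : set S) (B : set T) : Prop :=
  A #<= B /\ ~ (B #<= A).

(* An infinite cardinal that is not a union of fewer than |K| sets, each of
   cardinality less than |K|.                                                *)
Definition regular_card (K : Type) : Prop :=
  infinite_set [set: K] /\
  forall (J : set K) (F : K -> set K),
    card_lt J [set: K] ->
    (forall j, J j -> card_lt (F j) [set: K]) ->
    \bigcup_(j in J) F j <> [set: K].

Definition succ_card (K L : Type) : Prop :=
  card_lt [set: K] [set: L] /\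
  forall M : Type, card_lt [set: K] [set: M] -> [set: L] #<= [set: M].

Fixpoint is_aleph (n : nat) (K : Type) : Prop :=
  if n is m.+1 then exists2 L : Type, is_aleph m L & succ_card L K
  else [set: K] #= [set: nat].

Section Pseudoradial.
Context {X : topologicalType}.

(* Convergence of a sequence of length |K|.  For regular |K| this is the usual
   convergence of a transfinite sequence of that length, so no order on the
   index type is needed.                                                     *)
Definition kseq_cvg (K : Type) (x_ : K -> X) (x : X) : Prop :=
  forall U : set X, nbhs x U -> card_lt [set a | ~ U (x_ a)] [set: K].

(* Lengths of sequences range over the regular cardinals: this is the standard
   notion, and for singular |K| the condition in [kseq_cvg] would be weaker
   than convergence along tails.                                             *)
Definition radially_closed (A : set X) : Prop :=
  forall (K : Type) (x_ : K -> X) (x : X),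
    regular_card K -> (forall a, A (x_ a)) -> kseq_cvg x_ x -> A x.

Definition radial_closure (A : set X) : set X := smallest radially_closed A.

End Pseudoradial.

Definition pseudoradial (X : topologicalType) : Prop :=
  forall A : set X, closed (radial_closure A).

Definition weakly_pseudoradial (X : topologicalType) : Prop :=
  forall A : set X, countable A -> closed (radial_closure A).

(* 2^K with the product of the discrete topologies. *)
Definition cantor_cube (K : Type) : topologicalType :=
  prod_topology (fun _ : K => bool).

(* [K] is the least cardinal whose cube is not pseudoradial. *)
Definition is_pse (K : Type) : Prop :=
  ~ pseudoradial (cantor_cube K) /\
  forall L : Type, ~ pseudoradial (cantor_cube L) -> [set: K] #<= [set: L].

(* Main.v *)
Require Import Defs.
From mathcomp Require Import all_boot all_classical topology.
From mathcomp Require Import wochoice.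

(** Let [R] be the radial closure of a subset of the product. Since the product
is weakly pseudoradial, [R] contains the closures of its countable subsets, and
the task is to find, in case [R] is not closed, a sequence in [R] of regular
length that converges to a point outside [R].

Call a point [p] of a closed set [H] approached if there are countably many
nonempty sets [K_n], each the intersection of [H] with aleph_1 many closed
[G_delta] sets, such that every neighbourhood of [p] contains one of them. If
every nonempty closed set has an approached point, then [R] is closed
([radially_closed_closed]): take a shortest family of closed [G_delta] sets
whose intersection [H] meets the closure of [R] but misses [R], and an
approached point [p] of [H]. The length of the family is uncountable, so each
[K_n] is the limit of a sequence of points of [R] indexed by it, and these
countably many sequences can be combined into one that converges to [p] within [R],
because [R] contains the closures of its countable subsets. Having approached
points passes to products ([countably_approached_prod]).

It remains to see that a compact pseudoradial space [X] has approached points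
([pseudoradial_countably_approached]). This adapts the proof of Shapirovskii's
theorem on maps onto cubes. If a closed set [H] has none, a recursion of length
aleph_2 produces disjoint pairs of closed sets. At stage [w] there are at most
aleph_1 earlier pairs; as aleph_1 is at most the continuum, the cube over these
pairs has a countable dense subset, so countably many intersections of sides of
the pairs represent all of them. Because they approach no point, a new pair
splits a family of them that is dense in some cone of the cube
([exists_splits]). The cone is given by a finite condition on coordinates below
[w], so by pressing down the same cone occurs aleph_2 times ([pressing_down]).
There the pairs are independent, and a closed subspace of [X] maps onto a cube
whose exponent is the pseudoradial number. That cube would then be pseudoradial,
a contradiction ([dyadic_pseudoradial_cube]). *)

Set Implicit Arguments.
Unset Strict Implicit.
Unset Printing Implicit Defensive.

Local Open Scope classical_set_scope.
Local Open Scope card_scope.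

(** * Comparing cardinals *)

Lemma card_leTP (T U : Type) :
  [set: T] #<= [set: U] <-> exists f : T -> U, injective f.
Proof.
elim/Ppointed: U => U.
  rewrite emptyE; split=> [/eqP T0|[f _]]; last first.
    by apply/eqP; rewrite -subset0 => t _; exact: (no (f t)).
  have f (t : T) : U by have : [set: T] t by []; rewrite T0.
  by exists f => x; have : [set: T] x by []; rewrite T0.
split=> [/pcard_injP[f f_inj]|[f f_inj]].
  by exists f => x y xy; apply: f_inj => //; rewrite inE.
by apply/pcard_injP; exists f => x y _ _; exact: f_inj.
Qed.

Lemma card_le_subP (T U : Type) (A : set T) (B : set U) :
  A #<= B <-> exists f : A -> B, injective f.
Proof.
rewrite -card_leTP; split=> AB.
  apply: (card_le_trans _ (card_le_trans AB _)).
    by have /card_eqPle[] := card_setT A.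
  by have /card_eqPle[] := card_setT B.
apply: (card_le_trans _ (card_le_trans AB _)).
  by have /card_eqPle[] := card_setT A.
by have /card_eqPle[] := card_setT B.
Qed.

(** Cardinals are well ordered (Hönig's argument): in a maximal set of choice
functions on which every coordinate is injective, some coordinate is onto,
since otherwise a choice function avoiding all the values taken could be added.
That coordinate then injects into every other one. *)
Lemma card_min (I : Type) (J : I -> Type) :
  inhabited I -> exists i, forall k, [set: J i] #<= [set: J k].
Proof.
move=> [i0].
pose P (G : set (forall i, J i)) :=
  forall i g h, G g -> G h -> g i = h i -> g = h.
have [|G [PG Gmax]] := @Zorn_bigcup _ P.
  move=> F FP Ftot i g h [A FA Ag] [B FB Bh].
  have [AB|BA] := Ftot _ _ FA FB.
    by apply: (FP _ FB i) => //; exact: AB.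
  by apply: (FP _ FA i) => //; exact: BA.
have [i iP] : exists i, forall x : J i, exists2 g, G g & g i = x.
  apply: contrapT => /forallNP noi.
  have {}noi i : exists x : J i, forall g, G g -> g i <> x.
    by have /existsNP[x /forall2NP xP] := noi i; exists x => g Gg; case: (xP g).
  have [g0 g0P] : exists g0, forall i g, G g -> g i <> g0 i.
    by exists (fun i => projT1 (cid (noi i))) => i; exact: projT2 (cid (noi i)).
  apply: (Gmax (G `|` [set g0])).
    split; first by move=> g; left.
    by move=> /(_ g0 (or_intror erefl)) Gg0; exact: (g0P i0 g0).
  move=> i g h [Gg|->] [Gh|->] //; first exact: PG.
    by move=> /g0P; case.
  by move=> /esym/g0P; case.
exists i => k; apply/card_leTP.
exists (fun x => projT1 (cid2 (iP x)) k) => x y.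
case: cid2 => g /= Gg <-; case: cid2 => h /= Gh <-.
by move=> /(PG _ _ _ Gg Gh) ->.
Qed.

Lemma card_le_total (T U : Type) (A : set T) (B : set U) :
  A #<= B \/ B #<= A.
Proof.
have [i iP] := @card_min bool (fun b => if b then A : Type else B : Type)
  (inhabits true).
by case: i iP => iP; [left; move: (iP false)|right; move: (iP true)];
  rewrite card_leTP card_le_subP.
Qed.

Lemma card_ltNge (T U : Type) (A : set T) (B : set U) :
  card_lt A B <-> ~ (B #<= A).
Proof.
by split=> [[]//|AB]; split=> //; have [|/AB] := card_le_total A B.
Qed.

Lemma card_le_lt_trans (T U V : Type) (A : set T) (B : set U) (C : set V) :
  A #<= B -> card_lt B C -> card_lt A C.
Proof.
move=> AB [BC CB]; split; first exact: card_le_trans BC.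
by move=> CA; apply: CB; exact: card_le_trans AB.
Qed.

Lemma card_lt_le_trans (T U V : Type) (A : set T) (B : set U) (C : set V) :
  card_lt A B -> B #<= C -> card_lt A C.
Proof.
move=> [AB BA] BC; split; first exact: card_le_trans BC.
by move=> CA; apply: BA; exact: card_le_trans CA.
Qed.

(** A copy of [nat] inside [T] is shifted by one to make room for [None]. *)
Lemma card_le_option (T : Type) :
  infinite_set [set: T] -> [set: option T] #<= [set: T].
Proof.
move=> /infiniteP/card_leTP[e e_inj]; apply/card_leTP.
pose f (o : option T) := match o with
  | None => e 0%N
  | Some x => if pselect (exists n, x = e n) is left ex
              then e (projT1 (cid ex)).+1 else x
  end.
have fe n : f (Some (e n)) = e n.+1.
  rewrite /f; case: pselect => [ex|[]]; last by exists n.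
  by case: cid => m /= /e_inj ->.
have fN x : ~ (exists n, x = e n) -> f (Some x) = x.
  by rewrite /f; case: pselect.
have fcase x : (exists n, x = e n) \/ ~ (exists n, x = e n) by exact: EM.
exists f => -[x|] [y|] //.
- case: (fcase x) => [[n ->]|nx]; case: (fcase y) => [[m ->]|ny].
  + by rewrite !fe => /e_inj[->].
  + by rewrite fe fN // => ye; case: ny; exists n.+1.
  + by rewrite fe fN // => xe; case: nx; exists m.+1.
  + by rewrite !fN // => ->.
- case: (fcase x) => [[n ->]|nx]; first by rewrite fe => /e_inj.
  by rewrite fN //= => xe; case: nx; exists 0%N.
- case: (fcase y) => [[n ->]|nx]; first by rewrite fe => /e_inj.
  by rewrite fN //= => xe; case: nx; exists 0%N.
Qed.

Lemma card_leT_inP (T U : Type) (u : U) (A : set T) :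
  A #<= [set: U] <->
  exists f : T -> U, forall x y, A x -> A y -> f x = f y -> x = y.
Proof.
elim/Ppointed: U u => U u; first by have := no u.
split=> [/pcard_injP[f f_inj]|[f f_inj]].
  by exists f => x y Ax Ay; apply: f_inj; exact: mem_set.
by apply/pcard_injP; exists f => x y /set_mem Ax /set_mem Ay; exact: f_inj.
Qed.

(** * Well orders and initial ordinals *)

Record wo (T : Type) (le : T -> T -> Prop) : Prop := Wo {
  wo_total : forall x y, le x y \/ le y x;
  wo_trans : forall y x z, le x y -> le y z -> le x z;
  wo_anti : forall x y, le x y -> le y x -> x = y;
  wo_min : forall A : set T, A !=set0 ->
    exists2 x, A x & forall y, A y -> le x y }.

Lemma ex_wo (T : Type) : exists le : T -> T -> Prop, wo le.
Proof.
have [R Rwo] := well_ordering_principle {classic T}.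
have Rmin (A : set T) : A !=set0 ->
    exists2 x, A x & forall y, A y -> R x y.
  move=> [a Aa].
  have [|z [[zA zle] _]] := Rwo [pred x : {classic T} | `[< A x >]].
    by exists a; apply/asboolP.
  exists z; first by move: zA => /asboolP.
  by move=> y Ay; apply: zle; apply/asboolP.
have Rxx x : R x x by have [|y -> /(_ x)] := Rmin [set x]; [exists x|exact].
have Ranti x y : R x y -> R y x -> x = y.
  move=> xy yx.
  have [|z [_ zmin]] := Rwo [pred t : {classic T} | `[< t = x \/ t = y >]].
    by exists x; apply/asboolP; left.
  rewrite -(zmin x) ?(zmin y) //; split; do ?[by apply/asboolP; tauto].
    by move=> t /asboolP[] ->.
  by move=> t /asboolP[] ->.
exists R; split=> //.
- move=> x y; have [|z] := Rmin [set x; y]; first by exists x; left.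
  by move=> [] -> zmin; [left|right]; apply: zmin; [right|left].
- move=> y x z xy yz.
  have [|t] := Rmin [set x; y; z]; first by exists x; left; left.
  move=> [[]|] -> tmin; first by apply: tmin; right.
    by rewrite (Ranti _ _ xy) //; apply: tmin; left; left.
  by rewrite -(Ranti _ _ yz) //; apply: tmin; left; right.
Qed.

Section WoTheory.
Variables (T : Type) (le : T -> T -> Prop).
Hypothesis le_wo : wo le.

Lemma wo_refl x : le x x.
Proof. by case: (wo_total le_wo x x). Qed.

Lemma wo_nle x y : ~ le x y -> le y x.
Proof. by case: (wo_total le_wo x y). Qed.

Lemma wo_wf : well_founded (fun x y => ~ le y x).
Proof.
move=> x; apply: contrapT => nx.
have [|y ny ymin] := wo_min le_wo (A := [set x | ~ Acc (fun x y => ~ le y x) x]).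
  by exists x.
apply: ny; split=> z zy; apply: contrapT => nz.
by apply: zy; exact: ymin.
Qed.

Lemma wo_ind (P : T -> Prop) :
  (forall x, (forall y, ~ le x y -> P y) -> P x) -> forall x, P x.
Proof. by move=> IH x; elim: (wo_wf x) => y _; exact: IH. Qed.

End WoTheory.

(** The order type is an initial ordinal; for infinite [T] the closed initial
segments may be used in place of the open ones. *)
Definition initial (T : Type) (le : T -> T -> Prop) : Prop :=
  wo le /\ forall x, card_lt [set y | le y x] [set: T].

(** Unless a well order of [T] is already initial, it has a least [b] whose
initial segment is as large as [T]; the order is pulled back along an injection
of [T] into the elements strictly below [b]. *)
Lemma ex_initial (T : Type) : infinite_set [set: T] ->
  exists le : T -> T -> Prop, initial le.
Proof.
move=> Tinf; have [le lewo] := ex_wo T.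
case: (pselect (forall x, card_lt [set y | le y x] [set: T])) => [small|].
  by exists le.
move=> /existsNP big.
have [b bbig bmin] := wo_min lewo big.
have {}bmin y : ~ le b y -> card_lt [set z | le z y] [set: T].
  by move=> by_; apply: contrapT => /bmin.
have Tb : [set: T] #<= [set y | le y b].
  by apply: contrapT => /card_ltNge.
pose S := [set y | ~ le b y].
have TS : [set: T] #<= S.
  have bS : [set y | le y b] #<= [set: option S].
    apply/card_le_subP.
    exists (fun y => SigSub (mem_set (I : setT (insub (val y) : option S)))).
    move=> [x xb] [y yb] /= [].
    have xb' : le x b := set_mem xb; have yb' : le y b := set_mem yb.
    case: insubP => [u xS ux|xS]; case: insubP => [v yS vy|yS] //.
      by move=> [uv]; apply: val_inj; rewrite /= -ux -vy uv.
    move=> _; apply: val_inj => /=.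
    have bx : le b x by apply: contrapT => h; move/negP: xS; apply; rewrite inE.
    have by_ : le b y by apply: contrapT => h; move/negP: yS; apply; rewrite inE.
    by rewrite -(wo_anti lewo bx) // -(wo_anti lewo by_).
  have Sinf : infinite_set [set: S].
    have Tinf' : infinite_set [set: option S].
      by move=> /(card_le_finite (card_le_trans Tb bS)).
    move=> Sfin; apply: Tinf'.
    rewrite (_ : [set: option S] = [set None] `|` Some @` [set: S]).
      by rewrite finite_setU; split=> //; exact: finite_image.
    by apply/seteqP; split=> // -[x|] _; [right; exists x|left].
  apply: (card_le_trans Tb); apply: (card_le_trans bS).
  apply: (card_le_trans (card_le_option Sinf)).
  by have /card_eqPle[] := card_setT S.
have /card_le_subP[g0 g0_inj] := TS.
pose inT (t : T) : [set: T] := SigSub (mem_set (I : setT t)).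
pose g t := val (g0 (inT t)).
have g_inj : injective g by move=> x y /val_inj/g0_inj[].
have gS t : ~ le b (g t) by have := set_mem (valP (g0 (inT t))).
exists (fun x y => le (g x) (g y)); split; first split.
- by move=> x y; exact: (wo_total lewo).
- by move=> y x z; exact: (wo_trans lewo).
- by move=> x y xy yx; apply: g_inj; exact: (wo_anti lewo).
- move=> A [a Aa]; have [|_ [x Ax <-] xmin] := wo_min lewo (A := g @` A).
    by exists (g a); exists a.
  by exists x => // y Ay; apply: xmin; exists y.
move=> x; apply: card_le_lt_trans (bmin _ (gS x)).
rewrite -(card_le_eql (inj_card_eq (f := g) _)); last by move=> ? ? _ _ /g_inj.
by apply: subset_card_le => _ [y yx <-].
Qed.

(** * The first two uncountable cardinals *)

(** Transfinite recursion sends [x] to a value not taken below [x]; totality of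
[lt] makes this map injective. *)
Lemma card_le_segments (P T : Type) (lt : P -> P -> Prop) :
  well_founded lt -> (forall x y, [\/ x = y, lt x y | lt y x]) ->
  (forall x, card_lt [set y | lt y x] [set: T]) ->
  [set: P] #<= [set: T].
Proof.
move=> lt_wf lt_total small.
case: (pselect (exists t : T, True)) => [[t0 _]|noT]; last first.
  apply/card_leTP; suff f : P -> False by exists (fun x => False_rect T (f x)) => x.
  move=> x; have [_] := small x; apply.
  rewrite (_ : [set: T] = set0) ?card_ge0 //.
  by apply/seteqP; split=> // t; case: noT; exists t.
pose get (Q : set T) :=
  if pselect (exists t, Q t) is left e then projT1 (cid e) else t0.
have getP Q : (exists t, Q t) -> Q (get Q).
  by move=> Qt; rewrite /get; case: pselect => // e; exact: projT2 (cid e).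
pose F x (rec : forall y, lt y x -> T) : T :=
  get [set t | forall y (h : lt y x), t <> rec y h].
pose g := Fix lt_wf (fun _ => T) F.
have gE x : g x = get [set t | forall y, lt y x -> t <> g y].
  rewrite /g Fix_eq // => z f h fh; congr (get _).
  by apply/seteqP; split=> t /= tP y yz; [rewrite -fh|rewrite fh].
have gP x y : lt y x -> g x <> g y.
  suff : [set t | forall y, lt y x -> t <> g y] (g x) by exact.
  rewrite gE; apply: getP; apply: contrapT => /forallNP none.
  have [_] := small x; case; apply: card_le_trans (card_image_le g _).
  apply: subset_card_le => t _; have /existsNP[z] := none t.
  by move=> /not_implyP[zx /contrapT ->]; exists z.
apply/card_leTP; exists g => x y gxy.
by case: (lt_total x y) => // [/gP|/gP]; rewrite gxy.
Qed.

(** The cardinal aleph_1, as the successor of the cardinal of [nat]. *)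
Definition first_uncountable (L : Type) : Prop :=
  card_lt [set: nat] [set: L] /\
  forall M : Type, card_lt [set: nat] [set: M] -> [set: L] #<= [set: M].

(** Pairs are compared by their maximum first: the pairs below a given one lie
in the square of a countable initial segment of [L]. *)
Lemma card_le_square (L : Type) :
  first_uncountable L -> [set: L * L] #<= [set: L].
Proof.
move=> [natL Lmin].
have [le [lewo small]] : exists le : L -> L -> Prop, initial le.
  by apply: ex_initial; apply/infiniteP; case: natL.
have cseg x : countable [set y | le y x].
  apply: contrapT => /card_ltNge nats; have [_] := small x; apply.
  have /card_eqPle[s1 s2] := card_setT [set y | le y x].
  by apply: card_le_trans s1; apply: Lmin; exact: card_lt_le_trans nats s2.
have [rho rhowo] := ex_wo (L * L)%type.
pose m (p : L * L) := if pselect (le p.1 p.2) then p.2 else p.1.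
have m1 p : le p.1 (m p).
  by rewrite /m; case: pselect => //= _; exact: wo_refl lewo _.
have m2 p : le p.2 (m p).
  by rewrite /m; case: pselect => /= [_|/(wo_nle lewo)//]; exact: wo_refl lewo _.
pose lt p q := ~ le (m q) (m p) \/ (m q = m p /\ ~ rho q p).
apply: (@card_le_segments _ _ lt).
- move=> x; apply: contrapT => nx.
  have [|_ [y ny <-] ymin] := wo_min lewo (A := m @` [set x | ~ Acc lt x]).
    by exists (m x); exists x.
  have [|z [nz zy] zmin] :=
      wo_min rhowo (A := [set x | ~ Acc lt x /\ m x = m y]).
    by exists y.
  apply: nz; split=> t tz; apply: contrapT => nt.
  case: tz; first by rewrite zy; apply; apply: ymin; exists t.
  by move=> [zt]; apply; apply: zmin; split=> //; rewrite -zt.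
- move=> p q; case: (pselect (le (m p) (m q))) => pq; last first.
    by apply: Or33; left.
  case: (pselect (le (m q) (m p))) => qp; last by apply: Or32; left.
  have pqE := wo_anti lewo pq qp.
  case: (pselect (rho p q)) => rpq; last by apply: Or33; right.
  case: (pselect (rho q p)) => rqp; last by apply: Or32; right.
  by apply: Or31; exact: (wo_anti rhowo).
- move=> p; apply: card_le_lt_trans natL.
  apply: (sub_countable _ (countableX (cseg (m p)) (cseg (m p)))).
  apply: subset_card_le => q qp /=.
  have qm : le (m q) (m p).
    by case: qp => [/(wo_nle lewo)//|[-> _]]; exact: wo_refl lewo _.
  by split; [exact: (wo_trans lewo (m1 q))|exact: (wo_trans lewo (m2 q))].
Qed.

Section Square.
Variable L : Type.
Hypothesis Linf : infinite_set [set: L].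
Hypothesis LL : [set: L * L] #<= [set: L].

Lemma card_le_bigcup (T J : Type) (D : set J) (F : J -> set T) :
  D #<= [set: L] -> (forall j, D j -> F j #<= [set: L]) ->
  \bigcup_(j in D) F j #<= [set: L].
Proof.
move: LL => /card_leTP[p p_inj].
have [l0 _] := infinite_setN0 Linf.
move=> /(card_leT_inP l0)[d d_inj] FL.
have {}FL j : exists f : T -> L,
    D j -> forall x y, F j x -> F j y -> f x = f y -> x = y.
  case: (pselect (D j)) => [|nD]; last by exists (fun => l0).
  by move=> /FL/(card_leT_inP l0)[f f_inj]; exists f.
pose f j := projT1 (cid (FL j)).
have fP j : D j -> forall x y, F j x -> F j y -> f j x = f j y -> x = y.
  exact: projT2 (cid (FL j)).
pose ix t := if pselect (exists2 j, D j & F j t) is left e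
  then Some (projT1 (cid2 e)) else None.
have ixP t : (\bigcup_(j in D) F j) t ->
    exists j, [/\ D j, F j t & ix t = Some j].
  move=> tF; rewrite /ix; case: pselect => // e.
  by case: cid2 => j Dj Fj; exists j.
apply/(card_leT_inP l0).
exists (fun t => if ix t is Some j then p (d j, f j t) else l0).
move=> x y /ixP[j [Dj Fjx ->]] /ixP[k [Dk Fky ->]].
move=> /p_inj [djk fxy].
have jk : j = k by exact: d_inj.
by subst k; exact: (fP j).
Qed.

Lemma card_le_seq (T : Type) :
  [set: T] #<= [set: L] -> [set: seq T] #<= [set: L].
Proof.
move=> /card_leTP[d d_inj]; move: LL => /card_leTP[p p_inj].
have /card_leTP[e e_inj] := (infiniteP _).1 Linf.
pose fix c (s : seq T) := if s is x :: s' then p (d x, c s') else e 0%N.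
have c_inj s t : size s = size t -> c s = c t -> s = t.
  by elim: s t => [|x s IH] [|y t] //= [st] /p_inj[/d_inj -> /(IH _ st) ->].
apply/card_leTP; exists (fun s => p (e (size s), c s)) => s t.
by move=> /p_inj[/e_inj]; exact: c_inj.
Qed.

End Square.

Lemma is_aleph1P (L : Type) : is_aleph 1 L -> first_uncountable L.
Proof.
move=> [N /card_eqPle[Nnat natN] [NL NLmin]]; split.
  by exact: card_le_lt_trans NL.
by move=> M natM; apply: NLmin; exact: card_le_lt_trans natM.
Qed.

Lemma first_uncountable_infinite (L : Type) :
  first_uncountable L -> infinite_set [set: L].
Proof. by move=> [[natL _] _]; apply/infiniteP. Qed.

Lemma first_uncountable_le (L M : Type) (A : set M) :
  first_uncountable L -> ~ countable A -> [set: L] #<= A.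
Proof.
move=> [_ Lmin] /card_ltNge natA; have /card_eqPle[s1 s2] := card_setT A.
by apply: card_le_trans s1; apply: Lmin; exact: card_lt_le_trans s2.
Qed.

(** By Cantor's diagonal argument [nat -> bool] is uncountable. *)
Lemma first_uncountable_continuum (L : Type) :
  first_uncountable L -> [set: L] #<= [set: nat -> bool].
Proof.
move=> Lfu; apply: (first_uncountable_le Lfu) => /card_leTP[f f_inj].
pose D n := `[< exists2 g, f g = n & ~~ g n >].
case: (pselect (is_true (D (f D)))) => DfD.
  by case/asboolP: (DfD) => g /f_inj -> /negP.
by apply: (DfD); apply/asboolP; exists D => //; apply/negP.
Qed.

Section Successor.
Variables (L : Type) (W : eqType).
Hypotheses (Lfu : first_uncountable L) (LW : succ_card L W).

Let Linf := first_uncountable_infinite Lfu.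

Let LL : [set: L * L] #<= [set: L].
Proof. exact: card_le_square. Qed.

Lemma lt_succ_card (T : Type) (A : set T) :
  card_lt A [set: W] <-> A #<= [set: L].
Proof.
split=> [|AL]; last by exact: card_le_lt_trans AL LW.1.
move=> [_ WA]; apply: contrapT => /card_ltNge LA; apply: WA.
have /card_eqPle[s1 s2] := card_setT A.
by apply: card_le_trans s1; apply: LW.2; exact: card_lt_le_trans s2.
Qed.

Lemma succ_card_infinite : infinite_set [set: W].
Proof.
apply/infiniteP; have /infiniteP natL := Linf.
by apply: card_le_trans natL _; case: LW.1.
Qed.

Variable le : W -> W -> Prop.
Hypothesis le_initial : initial le.
Let le_wo : wo le := le_initial.1.

Let segL x : [set y | le y x] #<= [set: L].
Proof. by apply/lt_succ_card; exact: le_initial.2. Qed.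

(** The successor of [L] is regular: were [A] cofinal, [W] would be a union of
[L] many initial segments of size at most [L]. *)
Lemma succ_card_bounded (A : set W) : A #<= [set: L] ->
  exists b, forall x, A x -> ~ le b x.
Proof.
move=> AL; apply: contrapT => /forallNP unb.
case: LW.1 => _; apply.
apply: card_le_trans (card_le_bigcup Linf LL AL (fun x _ => segL x)).
apply: subset_card_le => y _; have /existsNP[x] := unb y.
by move=> /not_implyP[Ax /contrapT yx]; exists x.
Qed.

(** A form of Fodor's lemma for finite codes [s w] with coordinates below [w].
If every code is used at most [L] times, then all codes with coordinates up to
[b] are used only below some [h b], because there are at most [L] of them.
For the supremum [d] of the sequence of iterates of [h], the finitely many
coordinates of [s d] lie below one iterate, so [d] lies below the next. *)
Lemma pressing_down (s : W -> seq (W * bool)) :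
  (forall d p, p \in s d -> ~ le d p.1) ->
  exists c, [set: W] #<= [set d | s d = c].
Proof.
move=> s_below; apply: contrapT => /forallNP small.
have {}small c : [set d | s d = c] #<= [set: L].
  by apply/lt_succ_card/card_ltNge; exact: small.
pose codes b := [set c : seq (W * bool) | forall p, p \in c -> le p.1 b].
have codesL b : codes b #<= [set: L].
  have /card_leTP[e e_inj] :
      [set: set_type [set y | le y b] * bool] #<= [set: L].
    have /card_leTP[p p_inj] := LL.
    have /card_eqPle[s1 _] := card_setT [set y | le y b].
    have /card_leTP[f f_inj] := card_le_trans s1 (segL b).
    have /infiniteP/card_leTP[n n_inj] := Linf.
    apply/card_leTP; exists (fun q => p (f q.1, n (nat_of_bool q.2))).
    move=> [x b1] [y b2] /= /p_inj[/f_inj -> /n_inj].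
    by case: b1 b2 => [] [].
  have codeT : codes b #<= [set: seq (set_type [set y | le y b] * bool)].
    apply/(card_leT_inP [::]).
    exists (fun c => pmap (fun p => omap (fun x => (x, p.2)) (insub p.1)) c).
    move=> c d cb db.
    elim: c d cb db => [|p c IH] [|q d] //= cb db.
    - have qb : q.1 \in [set y | le y b] by rewrite inE; apply: db; rewrite mem_head.
      by rewrite insubT.
    - have pb : p.1 \in [set y | le y b] by rewrite inE; apply: cb; rewrite mem_head.
      by rewrite insubT.
    have pb : p.1 \in [set y | le y b] by rewrite inE; apply: cb; rewrite mem_head.
    have qb : q.1 \in [set y | le y b] by rewrite inE; apply: db; rewrite mem_head.
    rewrite !insubT /= => -[pq1 pq2 /IH ->].
    - by case: p q pq1 pq2 {cb db pb qb} => [? ?] [? ?] /= -> ->.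
    - by move=> r rc; apply: cb; rewrite inE rc orbT.
    - by move=> r rc; apply: db; rewrite inE rc orbT.
  apply: card_le_trans codeT (card_le_seq Linf LL _).
  by apply/card_leTP; exists e.
have next b : exists b', le b b' /\ forall d, codes b (s d) -> ~ le b' d.
  have [|b1 b1P] := @succ_card_bounded (\bigcup_(c in codes b) [set d | s d = c]).
    exact: (card_le_bigcup Linf LL (codesL b)).
  case: (wo_total le_wo b b1) => bb; [exists b1|exists b]; split=> //.
  - by move=> d db; apply: b1P; exists (s d).
  - exact: wo_refl le_wo _.
  by move=> d db /(wo_trans le_wo bb); apply: b1P; exists (s d).
pose h b := projT1 (cid (next b)).
have [hle hP] : (forall b, le b (h b)) /\
    (forall b d, codes b (s d) -> ~ le (h b) d).
  by split=> b; rewrite /h; case: cid => b' [].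
have [w0 _] := infinite_setN0 succ_card_infinite.
pose bs n := iter n h w0.
have bs_mono m n : (m <= n)%N -> le (bs m) (bs n).
  elim: n => [|n IH]; first by rewrite leqn0 => /eqP ->; exact: wo_refl le_wo _.
  rewrite leq_eqVlt => /orP[/eqP ->|/IH mn]; first exact: wo_refl le_wo _.
  exact: (wo_trans le_wo mn).
have [|b bP] := @succ_card_bounded (range bs).
  apply: card_le_trans (card_image_le _ _) _.
  by have /infiniteP := Linf.
have [|d dub dmin] := wo_min le_wo (A := [set d | forall n, le (bs n) d]).
  by exists b => n; apply: (wo_nle le_wo); apply: bP; exists n.
have below x : ~ le d x -> exists n, le x (bs n).
  move=> dx; apply: contrapT => /forallNP nx; apply: dx; apply: dmin => n.
  exact: (wo_nle le_wo).
have [n nP] : exists n, forall p, p \in s d -> le p.1 (bs n).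
  have : forall p, p \in s d -> exists n, le p.1 (bs n).
    by move=> p /s_below/below.
  elim: (s d) => [|p c IH] pc; first by exists 0%N.
  have [|n nP] := IH; first by move=> q qc; apply: pc; rewrite inE qc orbT.
  have [|m mP] := pc p; first by rewrite mem_head.
  exists (maxn m n) => q; rewrite inE => /orP[/eqP ->|/nP qn].
    by apply: (wo_trans le_wo mP); apply: bs_mono; exact: leq_maxl.
  by apply: (wo_trans le_wo qn); apply: bs_mono; exact: leq_maxr.
by apply: (hP (bs n) d nP); exact: (dub n.+1).
Qed.

End Successor.

(** * Regular closed G-delta sets *)

(** Each [c k.+1] lies in the interior of [c k], so that the intersection is
both closed and a [G_delta]. This topological form of a zero set of a continuous
real function is stable under finite intersections and continuous preimages. *)
Definition regular_Gdelta (Z : topologicalType) (C : set Z) : Prop :=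
  exists c : nat -> set Z,
    [/\ forall k, closed (c k), forall k, c k.+1 `<=` (c k)° &
        C = \bigcap_k c k].

Section RegularGdelta.
Variable Z : topologicalType.
Implicit Types C D : set Z.

Lemma regular_Gdelta_closed C : regular_Gdelta C -> closed C.
Proof. by move=> [c [ccl _ ->]]; apply: closed_bigI => k _. Qed.

Lemma regular_GdeltaT : regular_Gdelta [set: Z].
Proof.
exists (fun=> setT); split=> [k|k x _|]; [exact: closedT|exact: filterT|].
by apply/seteqP; split=> // x _ k.
Qed.

Lemma regular_GdeltaI C D :
  regular_Gdelta C -> regular_Gdelta D -> regular_Gdelta (C `&` D).
Proof.
move=> [c [ccl cint ->]] [d [dcl dint ->]].
exists (fun k => c k `&` d k); split=> [k|k|].
- exact: closedI.
- by rewrite interiorI => x [/cint cx /dint].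
by rewrite bigcapI.
Qed.

(** Normality is applied repeatedly, always keeping [C] in the interior. *)
Lemma regular_Gdelta_between C (O : set Z) :
  compact [set: Z] -> hausdorff_space Z -> closed C -> open O -> C `<=` O ->
  exists D, [/\ regular_Gdelta D, C `<=` D & D `<=` O].
Proof.
move=> Zc Zh Ccl Oo CO.
have shrink (P : set Z) : exists Q : set Z, C `<=` P° ->
    [/\ closed Q, C `<=` Q° & Q `<=` P°].
  case: (pselect (C `<=` P°)) => [CP|]; last by exists set0.
  have [|B BC BP] := compact_normal Zh Zc Ccl (_ : set_nbhs C P°).
    by move=> x /CP Px; exact: nbhs_interior.
  exists (closure B) => _; split=> //; first exact: closed_closure.
  by move=> x /BC; apply: filterS; exact: subset_closure.
pose g P := projT1 (cid (shrink P)).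
have gP P : C `<=` P° -> [/\ closed (g P), C `<=` (g P)° & g P `<=` P°].
  exact: projT2 (cid (shrink P)).
pose c k := iter k.+1 g O.
have Cc k : C `<=` (iter k g O)°.
  elim: k => [|k IH]; first by move/interior_id: Oo => /= ->.
  by have [] := gP _ IH.
exists (\bigcap_k c k); split.
- exists c; split=> // k; first by have [] := gP _ (Cc k).
  by have [] := gP _ (Cc k.+1).
- by move=> x Cx k _; apply: interior_subset; exact: Cc k.+1 x Cx.
- move=> x /(_ 0%N I); have [_ _ sub] := gP _ (Cc 0%N).
  by move=> /sub; exact: interior_subset.
Qed.

End RegularGdelta.

Lemma regular_Gdelta_preimage (Z T : topologicalType) (f : Z -> T) (C : set T) :
  continuous f -> regular_Gdelta C -> regular_Gdelta (f @^-1` C).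
Proof.
move=> fcont [c [ccl cint ->]].
exists (fun k => f @^-1` (c k)); split=> [k|k x /cint|//].
  by move/continuous_closedP: fcont; apply.
exact: fcont.
Qed.

(** * Compactness *)

Section Compact.
Variable Z : topologicalType.
Hypothesis Zc : compact [set: Z].

Lemma cluster_closed (F : set_system Z) (x : Z) (S : set Z) :
  cluster F x -> F S -> closed S -> S x.
Proof. by rewrite clusterE => Fx FS; apply; exact: Fx. Qed.

(** The finite intersection property, relative to a closed set [G] so that an
empty family causes no exception. *)
Lemma compact_meet (I : choiceType) (F : I -> set Z) (D : set I) (G : set Z) :
  closed G -> (forall i, D i -> closed (F i)) ->
  (forall s : seq I, (forall i, i \in s -> D i) ->
     exists2 z, G z & forall i, i \in s -> F i z) ->
  exists2 z, G z & forall i, D i -> F i z.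
Proof.
move=> Gcl Fcl fip.
pose B (s : seq I) := [set z | G z /\ forall i, i \in s -> F i z].
pose P := [set s : seq I | forall i, i \in s -> D i].
have Bfil : ProperFilter (filter_from P B).
  apply: filter_from_proper; last first.
    by move=> s /fip[z Gz zF]; exists z.
  apply: filter_from_filter; first by exists [::].
  move=> s t sP tP; exists (s ++ t).
    by move=> i; rewrite mem_cat => /orP[/sP|/tP].
  move=> z [Gz zF]; split; split=> // i ist; apply: zF.
    by rewrite mem_cat ist.
  by rewrite mem_cat ist orbT.
have [|z [_ zB]] := Zc Bfil; first exact: filterT.
exists z; first by apply: (cluster_closed zB) => //; exists [::] => // y [].
move=> i Di; apply: (cluster_closed zB); last exact: Fcl.
exists [:: i]; first by move=> j; rewrite inE => /eqP ->.
by move=> y [_]; apply; rewrite mem_head.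
Qed.

End Compact.

(** * Closures of radially closed sets *)

(** Every closed set [H] has a point [p] with a countable pi-network in [H]: the
sets [H `&` \bigcap_l E n l] are nonempty, and each neighbourhood of [p] contains
one of them. They need not be open in [H], only intersections of [L] many closed
[G_delta] sets, and the weaker requirement is what makes such points exist. *)
Definition countably_approached (L : Type) (Z : topologicalType) : Prop :=
  forall H : set Z, closed H -> H !=set0 ->
  exists (p : Z) (E : nat -> L -> set Z),
    [/\ forall n l, regular_Gdelta (E n l),
        forall n, exists2 z, H z & forall l, E n l z &
        forall U, nbhs p U ->
          exists n, forall z, H z -> (forall l, E n l z) -> U z].

Lemma filter_all_le (T : Type) (F : set_system T) (A : nat -> set T) n :
  Filter F -> (forall k, F (A k)) -> F [set x | forall k, (k <= n)%N -> A k x].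
Proof.
move=> FF FA; elim: n => [|n IH].
  by apply: filterS (FA 0%N) => x Ax k; rewrite leqn0 => /eqP ->.
apply: filterS (filterI (FA n.+1) IH) => x [An1 An] k.
by rewrite leq_eqVlt => /orP[/eqP ->|/An].
Qed.

Section RadiallyClosed.
Variables (L : Type) (Z : topologicalType).
Hypotheses (Lfu : first_uncountable L).
Hypotheses (Zc : compact [set: Z]) (Zh : hausdorff_space Z).
Variable R : set Z.
Hypothesis Rcount : forall C, countable C -> C `<=` R -> closure C `<=` R.

(** Points of [R] close to [z] can be chosen in finitely many of the sets at a
time; a cluster point of such a sequence is in the closure of a countable
subset of [R]. *)
Lemma meets_countably_many (F : nat -> set Z) (z : Z) :
  (forall k, regular_Gdelta (F k)) -> closure R z -> (forall k, F k z) ->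
  exists2 r, R r & forall k, F k r.
Proof.
move=> Fg Rz Fz.
pose c k := projT1 (cid (Fg k)).
have cP k : [/\ forall j, closed (c k j), forall j, c k j.+1 `<=` (c k j)° &
    F k = \bigcap_j c k j] by exact: projT2 (cid (Fg k)).
have cz k j : nbhs z (c k j).
  have [_ cint Fk] := cP k; apply: cint.
  by have := Fz k; rewrite Fk; apply.
have /choice[r rP] n : exists r, R r /\
    forall k, (k <= n)%N -> forall j, (j <= n)%N -> c k j r.
  have [|r [Rr rn]] := Rz
    [set x | forall k, (k <= n)%N -> forall j, (j <= n)%N -> c k j x].
    by apply: filter_all_le => k; exact: filter_all_le.
  by exists r.
have [x [_ xr]] : [set: Z] `&` cluster (r @ \oo) !=set0.
  by apply: Zc; exact: filterT.
have rc : closure (range r) x.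
  apply: (cluster_closed xr); last exact: closed_closure.
  by exists 0%N => // n _; apply: subset_closure; exists n.
exists x.
  apply: Rcount rc; last by move=> _ [n _ <-]; case: (rP n).
  exact: card_le_trans (card_image_le _ _) (card_lexx _).
move=> k; have [ccl _ ->] := cP k; move=> j _.
apply: (cluster_closed xr) => //; exists (maxn k j) => // n /=.
by rewrite geq_max => /andP[kn jn]; have [_] := rP n; apply.
Qed.

(** For a point [q] of the closure outside [R], the family of all regular
[G_delta] sets containing [q] has an intersection that meets the closure of [R]
but misses [R]. Among the families with this property one of least cardinality
is taken; then all smaller families whose intersection meets the closure of [R]
do meet [R]. *)
Lemma least_family (q : Z) : closure R q -> ~ R q ->
  exists (M : Type) (C : M -> set Z),
  [/\ forall m, regular_Gdelta (C m),
      exists2 z, closure R z & forall m, C m z,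
      forall z, R z -> ~ forall m, C m z &
      forall (D : set M) (F : M -> set Z), card_lt D [set: M] ->
        (forall m, regular_Gdelta (F m)) ->
        (exists2 z, closure R z & forall m, D m -> F m z) ->
        exists2 r, R r & forall m, D m -> F m r].
Proof.
move=> Rq nRq.
pose Q (S : set (set Z)) := [/\ forall C, S C -> regular_Gdelta C,
  exists2 z, closure R z & forall C, S C -> C z &
  forall z, R z -> ~ forall C, S C -> C z].
have Q0 : Q [set C | regular_Gdelta C /\ C q].
  split; [by move=> C []|by exists q => // C []|].
  move=> r Rr rC.
  have [| |x ->|D [Dg qD Dr]] :=
      regular_Gdelta_between Zc Zh (C := [set q]) (O := ~` [set r]).
  - exact: (accessible_closed_set1 (hausdorff_accessible Zh)).
  - apply: closed_openC.
    exact: (accessible_closed_set1 (hausdorff_accessible Zh)).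
  - by move=> /= qr; apply: nRq; rewrite qr.
  have /Dr : D r by apply: rC; split=> //; exact: qD.
  by apply.
have [[S QS] /= Smin] :=
  @card_min {S | Q S} (fun S => set_type (projT1 S)) (inhabits (exist _ _ Q0)).
have [Sg [z0 Rz0 z0S] SR] := QS.
exists (set_type S), val; split.
- by move=> m; apply: Sg; exact: set_mem (valP m).
- by exists z0 => // m; apply: z0S; exact: set_mem (valP m).
- move=> z Rz zS; apply: (SR z Rz) => C SC.
  exact: (zS (SigSub (mem_set SC))).
move=> D F [_ SD] Fg [z Rz zF]; apply: contrapT => /forall2NP noR.
have QF : Q (F @` D).
  split; [by move=> _ [m _ <-]|by exists z => // _ [m Dm <-]; exact: zF|].
  move=> r Rr rF; case: (noR r); first by apply.
  by apply=> m Dm; apply: rF; exists m.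
apply: SD; apply: (card_le_trans (Smin (exist _ _ QF))) => /=.
have /card_eqPle[s1 _] := card_setT (F @` D).
exact: card_le_trans s1 (card_image_le _ _).
Qed.

Hypothesis Zca : countably_approached L Z.

(** Let [H] be the intersection of a least family [C], and [p] a point of [H]
approached by [K_n] ([n] in [nat]). Refining [C] by the [L] many sets that cut
out [K_n] does not lengthen it, so each initial part of the refined family
contains a point [x n m] of [R]. For fixed [m], let [y m] cluster at the points
[x n m] along the filter generated by the sets of those [n] for which [K_n] is
inside a given neighbourhood of [p]; it is in the closure of a countable subset
of [R], hence in [R]. Since the length of [C] has uncountable cofinality, one
stage [m] serves all [n], and [y] converges to [p] along a cofinal sequence of
regular length. As [R] is radially closed, [p] is in [R], but [H] misses [R]. *)
Lemma radially_closed_closed : radially_closed R -> closed R.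
Proof.
move=> Rrad; apply: contrapT => /existsNP[q /not_implyP[Rq nRq]].
have [M [C [Cg [z0 Rz0 z0C] RC Mmin]]] := least_family Rq nRq.
have Mnc : ~ countable [set: M].
  move=> /card_leTP[e e_inj].
  pose F k := \bigcap_(m in [set m | e m = k]) C m.
  have Fg k : regular_Gdelta (F k).
    case: (pselect (exists m, e m = k)) => [[m mk]|nk].
      rewrite (_ : F k = C m) //; apply/seteqP; split=> z; first exact.
      by move=> Cz n /=; rewrite -mk => /e_inj ->.
    rewrite (_ : F k = setT); first exact: regular_GdeltaT.
    by apply/seteqP; split=> // z _ m /= mk; case: nk; exists m.
  have [|r Rr rF] := meets_countably_many Fg Rz0.
    by move=> k m _; exact: z0C.
  by apply: (RC r Rr) => m; exact: (rF (e m)).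
have LM := first_uncountable_le Lfu Mnc.
have Minf : infinite_set [set: M].
  by move=> /finite_set_countable.
have [leM [Mwo Msmall]] := ex_initial Minf.
(* Along a countable cofinal sequence one would find points of [R] with a
cluster point that is both in [R] and in every [C m]. *)
have bdd (b : nat -> M) : exists m, forall k, ~ leM m (b k).
  apply: contrapT => /forallNP unb.
  have /choice[r rP] k : exists r, R r /\
      forall m, (exists2 i, (i <= k)%N & leM m (b i)) -> C m r.
    have [i iP] : exists i, forall j, (j <= k)%N -> leM (b j) (b i).
      elim: k => [|k [i IH]].
        by exists 0%N => j; rewrite leqn0 => /eqP ->; exact: wo_refl Mwo _.
      case: (wo_total Mwo (b i) (b k.+1)) => bik.
        exists k.+1 => j; rewrite leq_eqVlt => /orP[/eqP ->|/IH ji].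
          exact: wo_refl Mwo _.
        exact: (wo_trans Mwo ji).
      by exists i => j; rewrite leq_eqVlt => /orP[/eqP ->//|/IH].
    have [|r Rr rC] := Mmin _ C (Msmall (b i)) Cg; first by exists z0.
    exists r; split=> // m [j jk mj]; apply: rC.
    by apply: (wo_trans Mwo mj); exact: iP.
  have [x [_ xr]] : [set: Z] `&` cluster (r @ \oo) !=set0.
  by apply: Zc; exact: filterT.
  have Rx : R x.
    apply: (@Rcount (range r)).
    - exact: card_le_trans (card_image_le _ _) (card_lexx _).
    - by move=> _ [n _ <-]; case: (rP n).
    apply: (cluster_closed xr); last exact: closed_closure.
    by exists 0%N => // n _; apply: subset_closure; exists n.
  apply: (RC x Rx) => m; have /existsNP[k /contrapT mk] := unb m.
  apply: (cluster_closed xr); last exact: regular_Gdelta_closed.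
  by exists k => // n kn; have [_] := rP n; apply; exists k.
have [m0 _] := infinite_setN0 Minf.
pose cofinal (S : set M) := forall m, exists2 s, S s & leM m s.
have cofT : cofinal setT by move=> m; exists m => //; exact: wo_refl Mwo _.
have [[S Scof] Smin] :=
  @card_min {S | cofinal S} (fun S => set_type (projT1 S))
    (inhabits (exist _ _ cofT)).
rewrite /= in Smin; pose K := set_type S.
have Kbdd (F : set K) : card_lt F [set: K] ->
    exists m, forall k, F k -> ~ leM m (val k).
  move=> [_ KF]; apply: contrapT => /forallNP unb; apply: KF.
  have cofF : cofinal (val @` F).
    move=> m; have /existsNP[k /not_implyP[Fk /contrapT mk]] := unb m.
    by exists (val k) => //; exists k.
  apply: (card_le_trans (Smin (exist _ _ cofF))) => /=.
  have /card_eqPle[s1 _] := card_setT [set val k | k in F].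
  exact: card_le_trans s1 (card_image_le _ _).
have Knc : ~ countable [set: K].
  move=> /card_leTP[e e_inj].
  pose b n := if pselect (exists k, e k = n) is left ex
    then val (projT1 (cid ex)) else m0.
  have [m mP] := bdd b; have [s Ss ms] := Scof m.
  pose k : K := SigSub (mem_set Ss).
  apply: (mP (e k)); rewrite /b; case: pselect => [ex|]; last by case; exists k.
  by case: cid => k' /= /e_inj ->.
have Kinf : infinite_set [set: K] by move=> /finite_set_countable.
(* [K] is regular because it is a cofinal set of least cardinality. *)
have Kreg : regular_card K.
  split=> // J F JK FK cover.
  have /choice[g gP] j : exists k : K, J j ->
      forall i, F j i -> leM (val i) (val k).
    case: (pselect (J j)) => [Jj|]; last by exists j.
    have [m mP] := Kbdd _ (FK j Jj); have [s Ss ms] := Scof m.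
    exists (SigSub (mem_set Ss)) => _ i /mP /(wo_nle Mwo) im.
    exact: (wo_trans Mwo im).
  have [|m mP] := Kbdd (g @` J).
    exact: card_le_lt_trans (card_image_le _ _) JK.
  have [s Ss ms] := Scof m; pose k : K := SigSub (mem_set Ss).
  have : setT k by []; rewrite -cover => -[j Jj /(gP j Jj) kg].
  by apply: (mP (g j)); [exists j|exact: (wo_trans Mwo ms)].
have [leK [Kwo Ksmall]] := ex_initial Kinf.
(* The sequence is indexed so that [top k] lies above all earlier elements: the
convergence condition then only discards an initial segment. *)
have /choice[top topP] k : exists m, forall i, leK i k -> ~ leM m (val i).
  by have [m mP] := Kbdd _ (Ksmall k); exists m => i; exact: mP.
have [sg sg_surj] : exists sg : M -> L, forall l, exists m, sg m = l.
  have [l0 _] := infinite_setN0 (first_uncountable_infinite Lfu).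
  have /card_leTP[e e_inj] := LM.
  exists (fun m => if pselect (exists l, e l = m) is left ex
    then projT1 (cid ex) else l0) => l.
  exists (e l); case: pselect => [ex|[]]; last by exists l.
  by case: cid => l' /= /e_inj.
pose H := closure R `&` \bigcap_m C m.
have Hcl : closed H.
  apply: closedI; first exact: closed_closure.
  by apply: closed_bigI => m _; exact: regular_Gdelta_closed.
have [|p [E [Eg En0 Ep]]] := Zca Hcl; first by exists z0; split=> // m _.
have [Rp pC] : H p.
  apply: Hcl => U /Ep[n nU]; have [z Hz zE] := En0 n.
  by exists z; split=> //; exact: nU.
have /choice[x xP] n : exists x : M -> Z, forall m, R (x m) /\
    forall m', leM m' m -> C m' (x m) /\ E n (sg m') (x m).
  suff /choice[f fP] : forall m, exists x, R x /\
      forall m', leM m' m -> C m' x /\ E n (sg m') x by exists f.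
  move=> m.
  have [||r Rr rF] := Mmin _ (fun m' => C m' `&` E n (sg m')) (Msmall m).
  - by move=> m'; exact: regular_GdeltaI.
  - have [z [Rz zC] zE] := En0 n; exists z => // m' _; split; last exact: zE.
    exact: zC.
  by exists r.
pose I (U : set Z) := [set n | forall z, H z -> (forall l, E n l z) -> U z].
have Gfil : ProperFilter (filter_from (nbhs p) I).
  apply: filter_from_proper; last exact: Ep.
  apply: filter_from_filter; first by exists setT; exact: filterT.
  move=> U V pU pV; exists (U `&` V); first exact: filterI.
  by move=> n nUV; split=> z Hz zE; have [] := nUV z Hz zE.
have /choice[y yP] m : exists y, cluster (x ^~ m @ filter_from (nbhs p) I) y.
  have [y [_ ycl]] :
      [set: Z] `&` cluster (x ^~ m @ filter_from (nbhs p) I) !=set0.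
    by apply: Zc; exact: filterT.
  by exists y.
have Ry m : R (y m).
  apply: (@Rcount (range (x ^~ m))).
  - exact: card_le_trans (card_image_le _ _) (card_lexx _).
  - by move=> _ [n _ <-]; case: (xP n m).
  apply: (cluster_closed (yP m)); last exact: closed_closure.
  exists setT; first exact: filterT.
  by move=> n _; apply: subset_closure; exists n.
apply: (RC p); last by move=> m; exact: pC.
apply: (Rrad K (y \o top)) => // [k|U pU]; first exact: Ry.
have [V pV VU] : filter_from (nbhs p) closure U.
  exact: (compact_regular Zh Zc filterT).
(* By compactness [x n m] is eventually in the open set if [K_n] is inside it. *)
have tail n : exists m0, I (V°) n -> forall m, leM m0 m -> V° (x n m).
  case: (pselect (I (V°) n)) => [In|]; last by exists m0.
  apply: contrapT => /forallNP none.
  have {}none m0' : exists2 m, leM m0' m & ~ V° (x n m).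
    have /not_implyP[_ /existsNP[m /not_implyP[m0m nV]]] := none m0'.
    by exists m.
  have [| | |z [Rz nVz] zCE] := compact_meet Zc (I := {classic M})
      (F := fun m => C m `&` E n (sg m)) (D := setT) (G := closure R `&` ~` V°).
  - apply: closedI; first exact: closed_closure.
    by apply: open_closedC; exact: open_interior.
  - by move=> m _; apply: closedI; exact: regular_Gdelta_closed.
  - move=> s _.
    have [mx mxP] : exists mx, forall m, m \in s -> leM m mx.
      elim: s => [|a s [mx IH]]; first by exists m0.
      case: (wo_total Mwo a mx) => amx.
        by exists mx => m; rewrite inE => /orP[/eqP ->|/IH].
      exists a => m; rewrite inE => /orP[/eqP ->|/IH mm].
        exact: wo_refl Mwo _.
      exact: (wo_trans Mwo mm).
    have [m mxm nVm] := none mx; have [Rx xCE] := xP n m.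
    exists (x n m); first by split=> //; exact: subset_closure.
    by move=> m' /mxP m'mx; apply: xCE; exact: (wo_trans Mwo m'mx).
  apply: nVz; apply: In.
    by split=> // m _; have [] := zCE m Logic.I.
  by move=> l; have [m <-] := sg_surj l; have [] := zCE m Logic.I.
have [al alP] := choice tail.
have [m1 m1P] := bdd al.
have [s Ss m1s] := Scof m1; pose k1 : K := SigSub (mem_set Ss).
apply: card_le_lt_trans (Ksmall k1); apply: subset_card_le => k /= nU.
apply: (wo_nle Kwo) => k1k; apply: nU.
have m1top : leM m1 (top k).
  by apply: (wo_trans Mwo m1s); apply: (wo_nle Mwo); exact: topP k1k.
apply: VU; apply: (cluster_closed (yP (top k))); last exact: closed_closure.
exists (V°); first exact: nbhs_interior.
move=> n In; apply: subset_closure; apply: interior_subset.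
apply: (alP n) => //; apply: (wo_trans Mwo _ m1top).
exact: (wo_nle Mwo).
Qed.

End RadiallyClosed.

(** * Products and dyadic families *)

Lemma compact_prod (X Y : topologicalType) :
  compact [set: X] -> compact [set: Y] -> compact [set: X * Y].
Proof.
move=> Xc Yc.
rewrite (_ : [set: X * Y] = [set: X] `*` [set: Y]); first exact: compact_setX.
by apply/seteqP.
Qed.

Lemma hausdorff_prod (X Y : topologicalType) :
  hausdorff_space X -> hausdorff_space Y -> hausdorff_space (X * Y)%type.
Proof.
move=> Xh Yh [x y] [x' y'] xy; congr (_, _).
  apply: Xh => U V xU x'V.
  have [|[z w] [/= Uz Vz]] := xy (fst @^-1` U) (fst @^-1` V) (cvg_fst xU).
    exact: (cvg_fst x'V).
  by exists z.
apply: Yh => U V yU y'V.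
have [|[z w] [/= Uw Vw]] := xy (snd @^-1` U) (snd @^-1` V) (cvg_snd yU).
  exact: (cvg_snd y'V).
by exists w.
Qed.

(** The first projection of [H] has a point [p] approached by sets [K_n]. The
part of [H] above [K_n] projects to a closed subset of [Y], with a point [y_n]
approached by sets [K_(n,m)]. If [y] is a cluster point of the [y_n] along the
indices for which [K_n] is close to [p], then the products of [K_n] and
[K_(n,m)] approach [(p, y)]. *)
Lemma countably_approached_prod (L : Type) (X Y : topologicalType) :
  compact [set: X] -> hausdorff_space X -> compact [set: Y] ->
  hausdorff_space Y ->
  countably_approached L X -> countably_approached L Y ->
  countably_approached L (X * Y)%type.
Proof.
move=> Xc Xh Yc Yh Xca Yca H Hcl [z0 Hz0].
have XYc := compact_prod Xc Yc.
have fst_cont : continuous (@fst X Y) by move=> z; exact: cvg_fst.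
have snd_cont : continuous (@snd X Y) by move=> z; exact: cvg_snd.
have closed_fst (C : set (X * Y)) : closed C -> closed (fst @` C).
  move=> Ccl; apply: (compact_closed Xh); apply: continuous_compact.
    exact: continuous_subspaceT.
  exact: (subclosed_compact Ccl XYc).
have closed_snd (C : set (X * Y)) : closed C -> closed (snd @` C).
  move=> Ccl; apply: (compact_closed Yh); apply: continuous_compact.
    exact: continuous_subspaceT.
  exact: (subclosed_compact Ccl XYc).
have [|p [E [Eg En0 Ep]]] := Xca _ (closed_fst _ Hcl).
  by exists z0.1; exists z0.
pose H' n := H `&` fst @^-1` (\bigcap_l E n l).
have H'cl n : closed (H' n).
  apply: closedI => //; move/continuous_closedP: fst_cont; apply.
  by apply: closed_bigI => l _; exact: regular_Gdelta_closed.
have {}Yca n : exists q : Y * (nat -> L -> set Y),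
    [/\ forall m l, regular_Gdelta (q.2 m l),
        forall m, exists2 y, (snd @` H' n) y & forall l, q.2 m l y &
        forall U, nbhs q.1 U ->
          exists m, forall y, (snd @` H' n) y -> (forall l, q.2 m l y) -> U y].
  have [|q [E' E'P]] := Yca _ (closed_snd _ (H'cl n)).
    have [_ [z Hz <-] zE] := En0 n.
    by exists z.2; exists z => //; split=> // l _; exact: zE.
  by exists (q, E').
have [q qP] := choice Yca.
pose I (U : set X) :=
  [set n | forall z, (fst @` H) z -> (forall l, E n l z) -> U z].
have Gfil : ProperFilter (filter_from (nbhs p) I).
  apply: filter_from_proper; last exact: Ep.
  apply: filter_from_filter; first by exists setT; exact: filterT.
  move=> U V pU pV; exists (U `&` V); first exact: filterI.
  by move=> n nUV; split=> z Hz zE; have [] := nUV z Hz zE.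
have [y [_ ycl]] :
    [set: Y] `&` cluster ((fun n => (q n).1) @ filter_from (nbhs p) I) !=set0.
  by apply: Yc; exact: filterT.
pose dec k : nat * nat := odflt (0%N, 0%N) (unpickle k).
have decK n m : dec (pickle (n, m)) = (n, m) by rewrite /dec pickleK.
exists (p, y), (fun k l => fst @^-1` (E (dec k).1 l) `&`
  snd @^-1` ((q (dec k).1).2 (dec k).2 l)); split.
- move=> k l; apply: regular_GdeltaI; apply: regular_Gdelta_preimage.
  + exact: fst_cont.
  + exact: Eg.
  + exact: snd_cont.
  + by have [] := qP (dec k).1.
- move=> k; have [_ qn0 _] := qP (dec k).1.
  have [_ [z [Hz zE] <-] zq] := qn0 (dec k).2.
  by exists z => // l; split; [exact: zE|exact: zq].
move=> O [[U V] /= [pU yV] UVO].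
have [|_ [[n In <-] Vn]] :=
    ycl ((fun n => (q n).1) @` I U) (V°) _ (nbhs_interior yV).
  by exists U => // n In; exists n.
have [_ _ /(_ V Vn) [m mV]] := qP n.
exists (pickle (n, m)) => -[x z] Hxz; rewrite decK /= => zE.
apply: UVO; split => /=.
  by apply: In => [|l]; [exists (x, z)|case: (zE l)].
apply: mV => [|l]; last by case: (zE l).
by exists (x, z) => //; split=> // l _; case: (zE l).
Qed.

Lemma radially_closed_radial_closure (X : topologicalType) (A : set X) :
  radially_closed (radial_closure A).
Proof.
move=> K x_ x Kreg xA xx T TA.
by apply: (TA.1 K x_ x) => // a; exact: xA.
Qed.

(** The pairs [(A i, B i)] define a continuous map from the closed set [F] of
points lying in one member of every pair, and independence makes it a
surjection onto the cube. The preimage of a radially closed set is radially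
closed, hence closed and compact, and so is its image. *)
Lemma dyadic_pseudoradial_cube (X : topologicalType) (P : Type)
    (A B : P -> set X) :
  compact [set: X] -> pseudoradial X ->
  (forall i, closed (A i)) -> (forall i, closed (B i)) ->
  (forall i x, A i x -> B i x -> False) ->
  (forall t : P -> bool, exists x, forall i, (if t i then A i else B i) x) ->
  pseudoradial (cantor_cube P).
Proof.
move=> Xc Xps Acl Bcl AB dyadic S.
set R := radial_closure S.
have Rrad : radially_closed R by exact: radially_closed_radial_closure.
pose f (x : X) : cantor_cube P := fun i => `[< A i x >].
pose F := \bigcap_i (A i `|` B i).
have Fcl : closed F by apply: closed_bigI => i _; exact: closedU.
have fcont : {within F, continuous f}.
  apply/subspace_continuousP => x Fx.
  apply/cvg_sup => i U [V [[W oW <-] /= Wfx] VU].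
  apply: filterS VU _; rewrite /within /=.
  case: (Fx i I) => [Ax|Bx].
    have nB : nbhs x (~` B i).
      by apply: open_nbhs_nbhs; split; [exact: closed_openC|move/(AB _ _ Ax)].
    apply: filterS nB => z nBz Fz; change (W (f z i)).
    have Az : A i z by case: (Fz i I).
    by rewrite (_ : f z i = f x i) // /f !asboolT.
  have nA : nbhs x (~` A i).
    by apply: open_nbhs_nbhs; split; [exact: closed_openC|move=> /AB/(_ Bx)].
  apply: filterS nA => z nAz Fz; change (W (f z i)).
  by rewrite (_ : f z i = f x i) // /f !asboolF // => /AB/(_ Bx).
pose R' := F `&` f @^-1` R.
have R'rad : radially_closed R'.
  move=> K x_ x Kreg xR' xx.
  have Fx : F x.
    apply: Fcl => U /xx [_ small]; apply: contrapT => FU.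
    apply: small; apply: subset_card_le => a _ /= Ua; apply: FU.
    by exists (x_ a); split=> //; case: (xR' a).
  split=> //; apply: (Rrad K (f \o x_)) => //= [a|U fU]; first by case: (xR' a).
  have := (subspace_continuousP F f).1 fcont x Fx U fU.
  move=> /xx; apply: card_le_lt_trans; apply: subset_card_le => a /= nU V.
  by apply: nU; apply: V; case: (xR' a).
have R'cl : closed R' by have := Xps R'; rewrite /radial_closure smallest_id.
have R'c : compact R' by exact: (subclosed_compact R'cl Xc).
rewrite (_ : R = f @` R').
  apply: compact_closed.
    apply: (@hausdorff_product {classic P} (fun=> bool)) => i.
    exact: discrete_hausdorff.
  apply: continuous_compact => //.
  by apply: continuous_subspaceW fcont => x [].
apply/seteqP; split=> [t Rt|_ [x [_ Rx] <-]//].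
have [x xP] := dyadic t.
have fx : f x = t.
  apply/funext => i; rewrite /f; have := xP i.
  case: (t i) => [Ax|Bx]; first by rewrite asboolT.
  by rewrite asboolF // => /AB/(_ Bx).
exists x => //; split; last by rewrite /preimage /= fx.
by move=> i _; have := xP i; case: (t i); [left|right].
Qed.

Lemma filter_all_seq (I : eqType) (T : Type) (F : set_system T)
    (A : I -> set T) (s : seq I) :
  Filter F -> (forall i, i \in s -> F (A i)) ->
  F [set x | forall i, i \in s -> A i x].
Proof.
move=> FF; elim: s => [|i s IH] FA; first by apply: filterE => x i.
apply: filterS (filterI (FA i (mem_head _ _)) (IH _)).
  by move=> x [Ai As] j; rewrite inE => /orP[/eqP ->|/As].
by move=> j js; apply: FA; rewrite inE js orbT.
Qed.

(** * Points with a countable pi-network *)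

(** A code records finitely many finite binary words, all of one length [k];
it describes the function that is true at [x] when the first [k] digits of the
binary sequence attached to [x] form one of these words. *)
Lemma separable_cube (T : eqType) (A : set T) :
  A #<= [set: nat -> bool] ->
  exists g : nat -> T -> bool, forall (f : T -> bool) (s : seq T),
    (forall x, x \in s -> A x) -> exists n, forall x, x \in s -> g n x = f x.
Proof.
move=> /(card_leT_inP (fun=> false))[r r_inj].
pose g n x := if unpickle n is Some (k, ws) then mkseq (r x) k \in (ws : seq _)
              else false.
exists g => f s sA.
have : \forall k \near \oo, forall x, x \in s -> forall y, y \in s ->
    mkseq (r x) k = mkseq (r y) k -> x = y.
  apply: filter_all_seq => x xs; apply: filter_all_seq => y ys.
  case: (pselect (x = y)) => [->|xy]; first (by exists 0%N).
  have [i ri] : exists i, r x i <> r y i.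
    apply: contrapT => /forallNP rE; apply: xy.
    apply: (r_inj _ _ (sA _ xs) (sA _ ys)); apply/funext => i.
    exact: contrapT (rE i).
  exists i.+1 => // k /= ik /(congr1 (fun w => nth false w i)).
  by rewrite !nth_mkseq.
move=> [k _ /(_ k (leqnn k)) kP].
exists (pickle (k, [seq mkseq (r x) k | x <- s & f x])) => x xs.
rewrite /g pickleK; apply/mapP/idP => [[y]|fx].
  by rewrite mem_filter => /andP[fy ys] /(kP _ xs _ ys) ->.
by exists x => //; rewrite mem_filter fx.
Qed.

Section Recursion.
Variables (X : topologicalType) (L : Type) (W : choiceType).
Hypotheses (Xc : compact [set: X]) (Xh : hausdorff_space X).
Variable (H : set X).
Hypotheses (Hcl : closed H) (H0 : H !=set0).
Variable le : W -> W -> Prop.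
Hypothesis le_wo : wo le.

(** The list is the graph of a finite partial function; it stands for the cone
of the binary functions extending it, on which the pair of sets is to be
independent of the earlier pairs. *)
Definition stage : Type := (seq (W * bool) * (set X * set X))%type.

Definition side (e : stage) (b : bool) : set X := if b then e.2.1 else e.2.2.

Definition fits (f : W -> bool) (e : stage) : Prop :=
  forall p, p \in e.1 -> f p.1 = p.2.

(** Only the stages whose condition agrees with [f] constrain the branch of [f];
so a pair has to be independent of the earlier ones on one cone of the cube
only, while [f] still ranges over the whole cube. *)
Definition branch (d : W -> stage) (S : set W) (f : W -> bool) : set X :=
  [set x | H x /\ forall w, S w -> fits f (d w) -> side (d w) (f w) x].

Definition below (w : W) : set W := [set v | ~ le w v].

Record splits (d : W -> stage) (w : W) (e : stage) : Prop := Splits {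
  splits_below : forall p, p \in e.1 -> below w p.1;
  splits_fits : exists f, fits f e;
  splits_Gdelta : forall b, regular_Gdelta (side e b);
  splits_disjoint : forall x, side e true x -> side e false x -> False;
  splits_branch : forall f, fits f e -> forall b,
    branch d (below w) f `&` side e b !=set0 }.

(** By compactness finitely many stages matter, and the last of them cuts the
branch determined by all earlier ones. *)
Lemma branch_nonempty (d : W -> stage) (S : set W) (f : W -> bool) :
  (forall w, S w -> splits d w (d w)) -> branch d S f !=set0.
Proof.
move=> Sd.
have [||x Hx xP] := compact_meet Xc (F := fun w => side (d w) (f w))
    (D := [set w | S w /\ fits f (d w)]) Hcl; last first.
- by exists x; split=> // w Sw fw; exact: xP.
- move=> s sD.
  have [->|[m ms mmax]] : s = [::] \/
      exists2 m, m \in s & forall w, w \in s -> le w m.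
    elim: s {sD} => [|w s IH]; [by left|right].
    case: IH => [->|[m ms mmax]].
      exists w; first by rewrite mem_head.
      by move=> v; rewrite inE => /eqP ->; exact: wo_refl le_wo _.
    case: (wo_total le_wo w m) => wm.
      exists m; first by rewrite inE ms orbT.
      by move=> v; rewrite inE => /orP[/eqP ->|/mmax].
    exists w; first by rewrite mem_head.
    move=> v; rewrite inE => /orP[/eqP ->|/mmax vm].
      exact: wo_refl le_wo _.
    exact: (wo_trans le_wo vm).
  by have [x Hx] := H0; exists x.
  have [Sm fm] := sD m ms.
  have [x [[Hx xb] xm]] := splits_branch (Sd m Sm) fm (f m).
  exists x => // w ws; have [Sw fw] := sD w ws.
  case: (pselect (le m w)) => [mw|nmw]; last exact: xb.
  by rewrite (wo_anti le_wo (mmax w ws) mw).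
- move=> w [Sw _]; apply: regular_Gdelta_closed.
  exact: splits_Gdelta (Sd w Sw) _.
Qed.

Hypothesis Lfu : first_uncountable L.
Hypothesis segL : forall w, below w #<= [set: L].
Hypothesis not_approached : ~ exists (p : X) (E : nat -> L -> set X),
  [/\ forall n l, regular_Gdelta (E n l),
      forall n, exists2 z, H z & forall l, E n l z &
      forall U, nbhs p U ->
        exists n, forall z, H z -> (forall l, E n l z) -> U z].

(** Let [g n] be dense among the binary functions on the predecessors of [w].
Their branches are intersections of [L] many regular [G_delta] sets, so no point
is approached by them: each [p] has a neighbourhood [U] containing none of them.
Pairs [(A, B)] are chosen with [A] a neighbourhood of [p] inside [U] and [B]
containing the complement of [U]; finitely many of the sets [A] cover [H], and
every branch meets every [B]. For one of these pairs the branches that meet [A]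
are dense in some cone: otherwise the cone could be shrunk for one pair after
the other, until it contains some [g n] whose branch meets no [A] of the cover.
By compactness, density gives a point in [A], and in [B], for every branch in
the cone. *)
Lemma exists_splits (d : W -> stage) (w : W) :
  (forall v, below w v -> splits d v (d v)) -> exists e, splits d w e.
Proof.
move=> dP.
have [g gP] := separable_cube
  (card_le_trans (segL w) (first_uncountable_continuum Lfu)).
pose K n := branch d (below w) (g n).
have K0 n : K n !=set0 by exact: branch_nonempty.
have [l0 _] := infinite_setN0 (first_uncountable_infinite Lfu).
have [c c_inj] := (card_leT_inP l0 _).1 (segL w).
pose E n l := [set x | forall v, below w v -> c v = l ->
  fits (g n) (d v) -> side (d v) (g n v) x].
have Eg n l : regular_Gdelta (E n l).
  case: (pselect (exists2 v, below w v /\ c v = l & fits (g n) (d v))).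
    move=> [v [vw vl] fv]; rewrite (_ : E n l = side (d v) (g n v)).
      exact: splits_Gdelta (dP v vw) _.
    apply/seteqP; split=> x; first by apply.
    by move=> xv u uw; rewrite -vl => /c_inj -> //.
  move=> nv; rewrite (_ : E n l = setT); first exact: regular_GdeltaT.
  by apply/seteqP; split=> // x _ v vw vl fv; case: nv; exists v.
have KE n x : K n x <-> H x /\ forall l, E n l x.
  split=> [[Hx xK]|[Hx xE]]; split=> //.
    by move=> l v vw _; exact: xK.
  by move=> v vw fv; apply: (xE (c v)).
have splitting (p : X) : exists P : set X * set X, [/\ regular_Gdelta P.1,
    regular_Gdelta P.2, forall x, P.1 x -> P.2 x -> False, nbhs p P.1 &
    forall n, K n `&` P.2 !=set0].
  have [U pU UK] : exists2 U, nbhs p U & forall n, K n `&` ~` U !=set0.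
    apply: contrapT => /forall2NP nU; apply: not_approached.
    exists p, E; split=> //.
      by move=> n; have [z /KE[Hz zE]] := K0 n; exists z.
    move=> U pU; case: (nU U) => // /existsNP[n nK]; exists n => z Hz zE.
    by apply: contrapT => nUz; apply: nK; exists z; split=> //; apply/KE.
  have [V pV VU] : filter_from (nbhs p) closure U°.
    apply: (compact_regular Xh Xc filterT); exact: nbhs_interior.
  have [||A [Ag VA AU]] := regular_Gdelta_between Xc Xh (C := closure V)
    (O := U°) _ _ VU; [exact: closed_closure|exact: open_interior|].
  have [|||B [Bg UB BA]] := regular_Gdelta_between Xc Xh (C := ~` U°)
    (O := ~` A).
  - by apply: open_closedC; exact: open_interior.
  - by apply: closed_openC; exact: regular_Gdelta_closed.
  - exact: subsetC.
  exists (A, B); split=> //=.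
  - by move=> x Ax /BA.
  - by apply: filterS pV; apply: subset_trans VA; exact: subset_closure.
  - move=> n; have [z [Kz nUz]] := UK n; exists z; split=> //; apply: UB.
    by move=> /interior_subset.
have [P PP] := choice splitting.
have [s sH] : exists s : seq {classic X},
    forall z, H z -> exists2 p, p \in s & (P p).1 z.
  apply: contrapT => /forallNP noS.
  have [| |z Hz zP] := compact_meet Xc (I := {classic X})
      (F := fun p => ~` ((P p).1)°) (D := setT) Hcl.
  - by move=> p _; apply: open_closedC; exact: open_interior.
  - move=> s _; have /existsNP[z /not_implyP[Hz zs]] := noS s.
    exists z => // p ps /interior_subset Pz; apply: zs.
    by exists p.
  apply: (zP z Logic.I); have [_ _ _ zz _] := PP z; exact: zz.
(* Finite conditions on coordinates below [w], and those defining a cone on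
which the branches meeting the first set of the pair at [p] are dense. *)
pose lower (c : seq (W * bool)) := forall p, p \in c -> below w p.1.
pose agree (f : W -> bool) (c : seq (W * bool)) := forall p, p \in c -> f p.1 = p.2.
pose good p c := forall f, agree f c -> forall t : seq W,
  (forall v, v \in t -> below w v) ->
  exists n, (forall v, v \in t -> g n v = f v) /\ K n `&` (P p).1 !=set0.
have [p [a [ps alow [fa faP] pgood]]] : exists p a,
    [/\ p \in s, lower a, exists f, agree f a & good p a].
  apply: contrapT => nogood.
  suff [a [alow [f fP] aP]] : exists a, [/\ lower a, exists f, agree f a &
      forall n, agree (g n) a -> forall p, p \in s -> ~ (K n `&` (P p).1 !=set0)].
    have [|n nP] := gP f (map fst a).
      by move=> v /mapP[q /alow qa ->].
    have [z Kz] := K0 n; have [p ps Pz] := sH z (Kz.1).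
    apply: (aP n _ p ps); last by exists z.
    by move=> q qa; rewrite -fP // nP //; exact: map_f.
  have : forall p, p \in s -> forall a, lower a -> (exists f, agree f a) ->
      ~ good p a.
    by move=> p ps a alow af ga; apply: nogood; exists p, a.
  elim: s {sH nogood} => [|p s IH] bad.
    by exists [::]; split=> //; exists (fun=> true).
  have [|a [alow af aP]] := IH.
    by move=> q qs; apply: bad; rewrite inE qs orbT.
  have /existsNP[f /not_implyP[fa]] := bad p (mem_head _ _) a alow af.
  move=> /existsNP[t /not_implyP[tlow none]].
  exists (a ++ [seq (v, f v) | v <- t]); split.
  - move=> q; rewrite mem_cat => /orP[/alow//|/mapP[v vt ->]].
    exact: tlow.
  - exists f => q; rewrite mem_cat => /orP[/fa//|/mapP[v vt ->]//].
  move=> n gn q; rewrite inE => /orP[/eqP ->|qs].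
    move=> KP; apply: none; exists n; split=> // v vt.
    by apply: (gn (v, f v)); rewrite mem_cat map_f ?orbT.
  by apply: aP => // r ra; apply: gn; rewrite mem_cat ra.
have [Ag Bg AB _ KB] := PP p.
exists (a, P p); split=> //=.
- by exists fa.
- by case.
move=> f fita b.
have [| | |x [Hx bx] xK] := compact_meet Xc (G := H `&` side (a, P p) b)
    (F := fun v => side (d v) (f v)) (D := [set v | below w v /\ fits f (d v)]);
  last by exists x; split=> //; split=> // v vw fv; exact: xK.
- apply: closedI => //; apply: regular_Gdelta_closed; case: b; [exact: Ag|exact: Bg].
- by move=> v [vw _]; apply: regular_Gdelta_closed; exact: splits_Gdelta (dP v vw) _.
move=> t tD.
pose t' := t ++ flatten [seq map fst (d v).1 | v <- t].
have t'low v : v \in t' -> below w v.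
  rewrite mem_cat => /orP[/tD[]//|/flatten_mapP[u /tD[uw _]] /mapP[q qu ->]].
  have qu' := splits_below (dP u uw) qu.
  by move=> wq; apply: uw; apply: (wo_trans le_wo wq); exact: (wo_nle le_wo).
have [n [gn [x [[Hx xK] xb]]]] : exists n,
    (forall v, v \in t' -> g n v = f v) /\ K n `&` side (a, P p) b !=set0.
  case: b; first exact: pgood.
  by have [n gn] := gP f t' t'low; exists n.
exists x => // v vt; have [vw fv] := tD v vt.
rewrite -gn ?mem_cat ?vt //; apply: xK => // q qv.
rewrite gn; first exact: fv.
rewrite mem_cat; apply/orP; right; apply/flatten_mapP; exists v => //.
exact: map_f.
Qed.

Lemma exists_system : exists d : W -> stage, forall w, splits d w (d w).
Proof.
have splits_ext d d' w e : (forall v, below w v -> d v = d' v) ->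
    splits d w e -> splits d' w e.
  move=> dd' [e1 e2 e3 e4 e5]; split=> // f fe b.
  have [x [[Hx xb] xe]] := e5 f fe b; exists x; split=> //; split=> // v vw.
  by rewrite -dd' //; exact: xb.
pose e0 : stage := ([::], (set0, set0)).
pose ext w (rec : forall v, below w v -> stage) v :=
  if pselect (below w v) is left h then rec v h else e0.
pose F w rec := if pselect (exists e, splits (ext w rec) w e) is left ex
  then projT1 (cid ex) else e0.
pose d := Fix (wo_wf le_wo) (fun=> stage) F.
have dE w : d w = F w (fun v _ => d v).
  rewrite /d Fix_eq // => x f h fh; congr F.
  by apply: functional_extensionality_dep => y; apply/funext => yx; exact: fh.
exists d; apply: (wo_ind le_wo) => w IH.
have extd v : below w v -> d v = ext w (fun v _ => d v) v.
  by rewrite /ext; case: pselect.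
have [e eP] := exists_splits IH.
rewrite dE /F; case: pselect => [ex|[]]; last first.
  by exists e; exact: splits_ext extd eP.
by case: cid => e' /=; apply: splits_ext => v /extd.
Qed.

End Recursion.

(** * Products of pseudoradial spaces *)

(** If no point of [H] has the required pi-network, the recursion runs through
all of [W]. By pressing down, one condition [c] is used [|W|] times; on the cone
of [c] these pairs are independent outright, and a closed subspace of [X] maps
onto the cube. *)
Lemma pseudoradial_countably_approached (X : topologicalType) (L W P : Type) :
  compact [set: X] -> hausdorff_space X -> pseudoradial X ->
  first_uncountable L -> succ_card L W -> [set: P] #<= [set: W] ->
  ~ pseudoradial (cantor_cube P) ->
  countably_approached L X.
Proof.
move=> Xc Xh Xps Lfu LW PW nP H Hcl H0; apply: contrapT => nH; apply: nP.
pose W' : choiceType := {classic W}.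
have LW' : succ_card L W' := LW.
have [le [le_wo small]] : exists le : W' -> W' -> Prop, initial le.
  exact: ex_initial (succ_card_infinite Lfu LW').
have segL w : below le w #<= [set: L].
  apply/(lt_succ_card LW'); apply: card_le_lt_trans (small w).
  by apply: subset_card_le => v /(wo_nle le_wo).
have [d dP] := exists_system Xc Xh Hcl H0 le_wo Lfu segL nH.
have [c Wc] := pressing_down Lfu LW' (conj le_wo small)
  (fun w p pw => splits_below (dP w) pw).
have /card_le_subP[i0 i0_inj] := card_le_trans PW Wc.
pose inT (q : P) : [set: P] := SigSub (mem_set (Logic.I : setT q)).
pose i q : W' := val (i0 (inT q)).
have i_inj : injective i by move=> x y /val_inj/i0_inj[].
have ic q : (d (i q)).1 = c by exact: set_mem (valP (i0 (inT q))).
pose A q := side (d (i q)) true; pose B q := side (d (i q)) false.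
apply: (dyadic_pseudoradial_cube (A := A) (B := B)) => //.
- by move=> q; apply: regular_Gdelta_closed; exact: splits_Gdelta (dP _) _.
- by move=> q; apply: regular_Gdelta_closed; exact: splits_Gdelta (dP _) _.
- by move=> q x; exact: splits_disjoint (dP _) _.
move=> t.
case: (pselect (exists q : P, True)) => [[q0 _]|noP]; last first.
  by have [x _] := H0; exists x => q; case: noP; exists q.
have [f0] := splits_fits (dP (i q0)); rewrite /fits ic => f0c.
(* [f] extends [c] and agrees with [t] on the chosen stages, which are never
coordinates of [c]. *)
pose f w := if w \in map fst c then f0 w else `[< exists2 q, i q = w & t q >].
have fi q : f (i q) = t q.
  rewrite /f ifF.
    by apply/asboolP/idP => [[r /i_inj ->]|tq] //; exists q.
  apply/negP => /mapP[p pc iq].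
  have := splits_below (dP (i q)); rewrite ic => /(_ p pc).
  by rewrite /below /= -iq; apply; exact: wo_refl le_wo _.
have [x [_ xd]] := branch_nonempty Xc Hcl H0 le_wo (S := setT) f
  (fun w _ => dP w).
exists x => q; have := xd (i q) Logic.I.
rewrite fi /side /A /B; case: (t q); apply.
all: by move=> p; rewrite ic => pc; rewrite /f map_f // f0c.
Qed.

Theorem theorem1p3 (pse aleph2 : Type)
  (pse_def : is_pse pse) (aleph2_def : is_aleph 2 aleph2)
  (pse_le_aleph2 : [set: pse] #<= [set: aleph2])
  (X Y : topologicalType)
  (X_compact : compact [set: X]) (X_hausdorff : hausdorff_space X)
  (X_pseudoradial : pseudoradial X)
  (Y_compact : compact [set: Y]) (Y_hausdorff : hausdorff_space Y)
  (Y_pseudoradial : pseudoradial Y)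
  (XY_weakly_pseudoradial : weakly_pseudoradial (X * Y)%type) :
  pseudoradial (X * Y)%type.
Proof.
have [L /is_aleph1P Lfu LW] := aleph2_def.
have [nP _] := pse_def.
have XYca : countably_approached L (X * Y)%type.
  by apply: countably_approached_prod => //;
    apply: (@pseudoradial_countably_approached _ _ aleph2 pse).
have XYc := compact_prod X_compact Y_compact.
have XYh := hausdorff_prod X_hausdorff Y_hausdorff.
move=> S; set R := radial_closure S.
have Rrad : radially_closed R by exact: radially_closed_radial_closure.
apply: (radially_closed_closed Lfu XYc XYh _ XYca) => // C Cc CR.
apply: (@subset_trans _ (radial_closure C)); last exact: smallest_sub.
apply: (@subset_trans _ (closure (radial_closure C))).
  by apply: closureS; exact: sub_gen_smallest.
exact: XY_weakly_pseudoradial.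
Qed.
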